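(* Let $n\ge 2$ and $0\le d\le n$, and let $\Omega\subset\mathbb{R}^n$, $\Omega\neq\mathbb{R}^n$, be a domain whose boundary $\partial\Omega$ is Ahlfors-regular with dimension $d$. Let $K\geq 1$ and let $u:\Omega\to[0,+\infty)$ be a $K$-quasi-nearly subharmonic function. Let $\varphi:[0,+\infty)\to[0,+\infty)$ be an admissible function with constants $r_0$ and $C_0$. Let $\alpha>0$ be arbitrary and put $$\rho_0:=\min\left\{\frac{r_0}{2^{1+\alpha}},\ \frac{r_0}{2^{3\alpha C_0}},\ \frac{\varphi(r_0)}{\alpha}\right\}.$$ Let $\gamma\in\mathbb{R}$ be such that $$\int_{\Omega}\delta(x)^{\gamma}u(x)\,dm(x)<+\infty.$$ Then there is a constant $C=C(n,\Omega,d,\varphi,\alpha,\gamma,K)>0$, depending only on the listed data (so depending on $u$ only through $K$), such that for all $\rho$ with $0<\rho\le\rho_0$, $$\int_{\partial\Omega}\ \sup_{x\in\Gamma_{\varphi,\rho}(\zeta,\alpha)}\left\{\delta(x)^{n+\gamma}\,[\varphi^{-1}(\delta(x))]^{-d}\,u(x)\right\}\,dH^d(\zeta)\ \le\ C\int_{\Omega_{\rho'}}\delta(x)^{\gamma}u(x)\,dm(x),$$ where $\rho'=\frac43\rho$.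
   Context: Notation: $m$ is Lebesgue measure in $\mathbb{R}^n$; $B^n(x,r)$ is the Euclidean ball with center $x$ and radius $r$; $\nu_n=m(B^n(0,1))$; $H^d$ is the $d$-dimensional Hausdorff (outer) measure in $\mathbb{R}^n$; $\delta(x)$ is the distance from $x\in\Omega$ to $\partial\Omega$; for $\rho>0$, $\Omega_\rho=\{x\in\Omega:\delta(x)<\rho\}$. Ahlfors-regular: a set $E\subset\mathbb{R}^n$ is Ahlfors-regular with dimension $d$ ($0\le d\le n$) if it is closed and there is a constant $C_4>0$ such that $H^d(E\cap B^n(x,r))\le C_4r^d$ for all $x\in E$ and $r>0$, and $C_4^{-1}r^d\le H^d(E\cap B^n(x,r))$ for all $x\in E$ and $0<r\le\operatorname{diam}E$ (all $r>0$ if $E$ is unbounded). Quasi-nearly subharmonic: for a domain $D\subset \mathbb{R}^n$ and $K\ge1$, a Lebesgue measurable function $u:D\to[-\infty,+\infty)$ is $K$-quasi-nearly subharmonic if $u^+$ is locally integrable on $D$ and, for every closed ball $\overline{B^n(x,r)}\subset D$ and every $M\ge0$, $$u_M(x)\le\frac{K}{\nu_n r^n}\int_{B^n(x,r)}u_M(y)\,dm(y),\qquad u_M:=\sup\{u,-M\}+M.$$ Admissible function: $\varphi:[0,+\infty)\to[0,+\infty)$ is admissible with constants $C_0\ge1$ and $r_0>0$ if it is strictly increasing, surjective, and $\varphi(2t)\le C_0\varphi(t)$ and $\varphi^{-1}(2s)\le C_0\varphi^{-1}(s)$ for all $0\le s,t\le r_0$. The constants $C_0,r_0$ are fixed together with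 $\varphi$, and dependence of a constant on $\varphi$ includes dependence on $C_0,r_0$. Approach regions: for $\zeta\in\partial\Omega$ and $\alpha>0$, $$\Gamma_\varphi(\zeta,\alpha)=\{x\in\Omega:\varphi(|x-\zeta|)<\alpha\,\delta(x)\},\qquad \Gamma_{\varphi,\rho}(\zeta,\alpha)=\{x\in\Gamma_\varphi(\zeta,\alpha):\delta(x)<\rho\}.$$ Suprema are taken in $[0,+\infty]$, the supremum over the empty set being $0$. *)

(* Defs.v *)
(* MathComp-Analysis development over an arbitrary R : realType.  R^n is
   'rV[R]_n with its canonical (product) topology; the canonical norm of
   'rV[R]_n is the sup norm, so the Euclidean norm is defined below and is
   the only one used for distances, balls and diameters. *)
From HB Require Import structures.
From mathcomp Require Import all_boot all_order all_algebra.
From mathcomp Require Import all_classical all_reals all_analysis.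
From mathcomp Require Import measurable_realfun.

Set Implicit Arguments.
Unset Strict Implicit.
Unset Printing Implicit Defensive.

Import Order.TTheory GRing.Theory Num.Theory.
Import numFieldNormedType.Exports.

Local Open Scope classical_set_scope.
Local Open Scope ring_scope.

Section euclidean.
Context {R : realType} {n : nat}.
Implicit Types (x y : 'rV[R]_n) (r : R) (E D : set 'rV[R]_n).

Definition enorm x : R := Num.sqrt (\sum_(i < n) x ord0 i ^+ 2).

Definition eball x r : set 'rV[R]_n := [set y | enorm (y - x) < r].

Definition ecball x r : set 'rV[R]_n := [set y | enorm (y - x) <= r].

(* The value is +oo when E is unbounded and 0 when E is empty. *)
Definition ediam E : \bar R :=
  maxe 0%E
    (ereal_sup [set t | exists x y, [/\ E x, E y & t = (enorm (x - y))%:E]]).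

Definition boundary D : set 'rV[R]_n := closure D `\` interior D.

(* Meaningful when [boundary D] is nonempty. *)
Definition bdist D x : R := inf [set enorm (x - z) | z in boundary D].

Definition domain D := [/\ open D, connected D & D !=set0].

End euclidean.

(* Outer measure of A: infimum of the total weight of the countable families Q
   of indices satisfying P whose sets S q cover A. *)
Section cover_outer.
Context {R : realType} {T : Type} {X : choiceType}.
Variables (P : set X) (S : X -> set T) (w : X -> \bar R).

Definition countable_cover (A : set T) : set (set X) :=
  [set Q | [/\ countable Q, Q `<=` P & A `<=` \bigcup_(q in Q) S q]].

Definition cover_outer (A : set T) : \bar R :=
  ereal_inf [set (\esum_(q in Q) w q)%E | Q in countable_cover A].

Hypothesis w_ge0 : forall q, P q -> (0 <= w q)%E.

Lemma cover_outer_ge0 A : (0 <= cover_outer A)%E.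
Proof.
by apply: le_ereal_inf_tmp => _ [Q [_ QP _] <-]; apply: esum_ge0 => q /QP/w_ge0.
Qed.

Lemma cover_outer0 : cover_outer set0 = 0%E.
Proof.
apply/eqP; rewrite eq_le cover_outer_ge0 andbT.
apply: ereal_inf_lbound; exists set0; last by rewrite esum_set0.
by split => //; exact: sub0set.
Qed.

Lemma le_cover_outer : {homo cover_outer : A B / A `<=` B >-> (A <= B)%E}.
Proof.
move=> A B AB; apply: ereal_inf_le_tmp => _ [Q [cQ QP BQ] <-].
by exists Q => //; split => //; exact: subset_trans BQ.
Qed.

Lemma esum_subset_le (Q Q' : set X) : Q `<=` Q' ->
  (\esum_(q in Q) w q <= \esum_(q in Q') w q)%E.
Proof.
move=> QQ'; apply: ge_ereal_sup => _ [F [fF FQ] <-].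
by apply: ereal_sup_ubound; exists F => //; split=> //; exact: subset_trans FQ QQ'.
Qed.

Lemma esum_bigcup_le (Q : (set X)^nat) : (forall k, Q k `<=` P) ->
  (\esum_(q in \bigcup_k Q k) w q <= \sum_(k <oo) \esum_(q in Q k) w q)%E.
Proof.
move=> QP; rewrite nneseries_esumT; last first.
  by move=> k; apply: esum_ge0 => q /QP/w_ge0.
rewrite seqDU_bigcup_eq esum_bigcup.
- by apply: le_esum => k _; apply: esum_subset_le; exact: subset_seqDU.
- apply: sub_trivIset (trivIset_seqDU Q); exact: subsetT.
- by move=> q [k _ /(@subset_seqDU _ Q) Qkq]; exact/w_ge0/(QP k).
Qed.

Lemma cover_outer_sigma_subadditive : sigma_subadditive cover_outer.
Proof.
move=> A; have [[i ioo]|] := pselect (exists i, cover_outer (A i) = +oo%E).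
  rewrite (eseries_pinfty _ _ ioo) ?leey// => k _.
  by rewrite -ltNye (lt_le_trans _ (cover_outer_ge0 _)).
rewrite -forallNE => Aoo.
apply/lee_addgt0Pr => e e0.
rewrite (le_trans _ (epsilon_trick _ _ (ltW e0)))//; last first.
  by move=> k; exact: cover_outer_ge0.
pose good k (Q : set X) := countable_cover (A k) Q /\
  (\esum_(q in Q) w q <= cover_outer (A k) + (e / (2 ^ k.+1)%:R)%:E)%E.
have [Q Qgood] : {Q : (set X)^nat & forall k, good k (Q k)}.
  apply: (@choice _ _ good) => k.
  have ek : 0 < e / (2 ^ k.+1)%:R by rewrite divr_gt0// ltr0n expn_gt0.
  have fk : cover_outer (A k) \is a fin_num.
    by rewrite ge0_fin_numE ?cover_outer_ge0// ltey; exact/eqP/Aoo.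
  have [_ [Q QA <-] /ltW Qlt] := lb_ereal_inf_adherent ek fk.
  by exists Q.
apply: (@le_trans _ _ (\esum_(q in \bigcup_k Q k) w q)).
  apply: ereal_inf_lbound; exists (\bigcup_k Q k) => //; split.
  - by apply: bigcup_countable => // k _; case: (Qgood k) => -[].
  - by move=> q [k _]; case: (Qgood k) => -[_ + _] _; exact.
  - move=> x [k _ Akx]; case: (Qgood k) => -[_ _ /(_ _ Akx)[q Qkq Sqx]] _.
    by exists q => //; exists k.
apply: le_trans (esum_bigcup_le _) _.
  by move=> k; case: (Qgood k) => -[].
apply: lee_nneseries => k _; last by case: (Qgood k).
by move=> _; apply: esum_ge0 => q; case: (Qgood k) => -[_ + _] _ => /[apply]/w_ge0.
Qed.

End cover_outer.

Section lebesgue.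
Context {R : realType} {n : nat}.
Implicit Types q : 'rV[R]_n * 'rV[R]_n.

Definition box q : set 'rV[R]_n :=
  [set x | forall i, q.1 ord0 i <= x ord0 i <= q.2 ord0 i].

Definition box_volume q : \bar R :=
  (\prod_(i < n) (q.2 ord0 i - q.1 ord0 i))%:E.

Definition proper_box : set ('rV[R]_n * 'rV[R]_n) :=
  [set q : 'rV[R]_n * 'rV[R]_n | forall i, q.1 ord0 i <= q.2 ord0 i].

Lemma box_volume_ge0 q : proper_box q -> (0 <= box_volume q)%E.
Proof. by move=> Pq; rewrite lee_fin; apply: prodr_ge0 => i _; rewrite subr_ge0. Qed.

Definition lebesgue_outer : set 'rV[R]_n -> \bar R :=
  cover_outer proper_box box box_volume.

HB.instance Definition _ := isOuterMeasure.Build R 'rV[R]_n lebesgue_outer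
  (cover_outer0 box box_volume_ge0) (cover_outer_ge0 box box_volume_ge0)
  (@le_cover_outer _ _ _ _ _ _) (cover_outer_sigma_subadditive box box_volume_ge0).

End lebesgue.

Section hausdorff.
Context {R : realType} {n : nat}.
Variable d : R.
Implicit Types (U A : set 'rV[R]_n) (e : R).

(* H^d_e, with covers by arbitrary sets of diameter at most e and no
   normalizing constant.  For d = 0 every set, even the empty one, has weight
   1; as covers may be empty this still gives H^0_e set0 = 0. *)
Definition hausdorff_content e : set 'rV[R]_n -> \bar R :=
  cover_outer [set U | (ediam U <= e%:E)%E] id (fun U => poweR (ediam U) d).

Definition hausdorff_outer A : \bar R :=
  ereal_sup [set hausdorff_content e A | e in [set e | 0 < e]].

Lemma le_hausdorff_outer (e : R) A : 0 < e ->
  (hausdorff_content e A <= hausdorff_outer A)%E.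
Proof. by move=> e0; apply: ereal_sup_ubound; exists e. Qed.

Lemma hausdorff_outer_ge0 A : (0 <= hausdorff_outer A)%E.
Proof.
apply: le_trans (le_hausdorff_outer A ltr01).
by apply: cover_outer_ge0 => U _; exact: poweR_ge0.
Qed.

Lemma hausdorff_outer0 : hausdorff_outer set0 = 0%E.
Proof.
apply/eqP; rewrite eq_le hausdorff_outer_ge0 andbT.
apply: ge_ereal_sup => _ [e _ <-].
by rewrite /hausdorff_content cover_outer0// => U _; exact: poweR_ge0.
Qed.

Lemma homo_hausdorff_outer :
  {homo hausdorff_outer : A B / A `<=` B >-> (A <= B)%E}.
Proof.
move=> A B AB; apply: ge_ereal_sup => _ [e e0 <-].
exact: le_trans (le_cover_outer _ _ _ AB) (le_hausdorff_outer B e0).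
Qed.

Lemma hausdorff_outer_sigma_subadditive : sigma_subadditive hausdorff_outer.
Proof.
move=> F; apply: ge_ereal_sup => _ [e e0 <-].
apply: le_trans (cover_outer_sigma_subadditive _ _ F) _.
  by move=> U _; exact: poweR_ge0.
apply: lee_nneseries => k _; last exact: le_hausdorff_outer.
by move=> _; apply: cover_outer_ge0 => U _; exact: poweR_ge0.
Qed.

HB.instance Definition _ := isOuterMeasure.Build R 'rV[R]_n hausdorff_outer
  hausdorff_outer0 hausdorff_outer_ge0 homo_hausdorff_outer
  hausdorff_outer_sigma_subadditive.

End hausdorff.

(* Both measures live on the Caratheodory sigma-algebra of their outer measure;
   for [leb] it consists of the Lebesgue measurable sets. *)
Section caratheodory_restrictions.
Context {R : realType} {n : nat}.

Definition leb : set (caratheodory_type (@lebesgue_outer R n)) -> \bar R :=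
  @lebesgue_outer R n.

Let outer_leb :=
  [the {outer_measure set 'rV[R]_n -> \bar R} of @lebesgue_outer R n].

HB.instance Definition _ := isMeasure.Build _ _ _ leb
  (@caratheodory_measure0 _ _ outer_leb)
  (@caratheodory_measure_ge0 _ _ outer_leb)
  (@caratheodory_measure_sigma_additive _ _ outer_leb).

Variable d : R.

Definition hausdorff :
    set (caratheodory_type (@hausdorff_outer R n d)) -> \bar R :=
  @hausdorff_outer R n d.

Let outer_hausdorff :=
  [the {outer_measure set 'rV[R]_n -> \bar R} of @hausdorff_outer R n d].

HB.instance Definition _ := isMeasure.Build _ _ _ hausdorff
  (@caratheodory_measure0 _ _ outer_hausdorff)
  (@caratheodory_measure_ge0 _ _ outer_hausdorff)
  (@caratheodory_measure_sigma_additive _ _ outer_hausdorff).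

End caratheodory_restrictions.

Arguments hausdorff {R n} d _.

Section notions.
Context {R : realType} {n : nat}.
Implicit Types (x zeta : 'rV[R]_n) (D E : set 'rV[R]_n).

(* When E is unbounded, ediam E = +oo and the lower bound holds for all r > 0. *)
Definition ahlfors_regular (d : R) E :=
  closed E /\
  exists2 C4 : R, 0 < C4 &
    (forall x r, E x -> 0 < r ->
      (hausdorff d (E `&` eball x r) <= (C4 * r `^ d)%:E)%E) /\
    (forall x r, E x -> 0 < r -> (r%:E <= ediam E)%E ->
      ((C4^-1 * r `^ d)%:E <= hausdorff d (E `&` eball x r))%E).

Definition nu : R := fine (leb (eball (0 : 'rV[R]_n) 1)).

Definition cutoff (M : R) (u : 'rV[R]_n -> \bar R) : 'rV[R]_n -> \bar R :=
  fun x => (maxe (u x) (- M)%:E + M%:E)%E.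

Local Notation lebT := (caratheodory_type (@lebesgue_outer R n)).

(* Only the restriction of u to D matters. *)
Definition quasi_nearly_subharmonic (K : R) D (u : 'rV[R]_n -> \bar R) :=
  [/\ forall x, D x -> (u x < +oo)%E,
      measurable_fun (D : set lebT) (u : lebT -> \bar R),
      forall A, compact A -> A `<=` D -> (\int[leb]_(x in A) (u^\+ x) < +oo)%E
    & forall x r M, 0 < r -> ecball x r `<=` D -> 0 <= M ->
        (cutoff M u x <=
         (K / (nu * r ^+ n))%:E * \int[leb]_(y in eball x r) cutoff M u y)%E].

(* Strict increase and surjectivity concern the restriction of phi to
   [0, +oo[; phi is arbitrary elsewhere. *)
Definition half_line_inv (phi : R -> R) : R -> R :=
  'pinv_(fun=> 0) `[0, +oo[%classic phi.

Definition admissible (phi : R -> R) (C0 r0 : R) :=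
  [/\ 1 <= C0 /\ 0 < r0,
      {in `[0, +oo[ &, {homo phi : s t / s < t}},
      phi @` `[0, +oo[%classic = `[0, +oo[%classic,
      forall t, 0 <= t <= r0 -> phi (2 * t) <= C0 * phi t
    & forall s, 0 <= s <= r0 ->
        half_line_inv phi (2 * s) <= C0 * half_line_inv phi s].

Definition approach (D : set 'rV[R]_n) (phi : R -> R) zeta (alpha : R) :
    set 'rV[R]_n :=
  [set x | D x /\ phi (enorm (x - zeta)) < alpha * bdist D x].

Definition boundary_strip D (rho : R) : set 'rV[R]_n :=
  [set x | D x /\ bdist D x < rho].

Definition truncated_approach D (phi : R -> R) (rho : R) zeta (alpha : R) :
    set 'rV[R]_n :=
  [set x | approach D phi zeta alpha x /\ bdist D x < rho].

(* Supremum in [0, +oo]: the supremum of the empty family is 0. *)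
Definition sup_nneg (A : set 'rV[R]_n) (f : 'rV[R]_n -> R) : \bar R :=
  maxe 0%E (ereal_sup [set (f x)%:E | x in A]).

End notions.

(* Main.v *)
Require Import Defs.
From mathcomp Require Import all_boot all_order all_algebra.
From mathcomp Require Import all_classical all_reals all_analysis.
From mathcomp Require Import measurable_realfun.
From mathcomp Require Import ring lra.

Set Implicit Arguments.
Unset Strict Implicit.
Unset Printing Implicit Defensive.

Import Order.TTheory GRing.Theory Num.Theory.
Import numFieldNormedType.Exports.

Local Open Scope classical_set_scope.
Local Open Scope ring_scope.

(** The proof averages [u] over a small ball and then exchanges a sum and an
    integral.

    Write [delta] for the distance to the boundary and [psi] for the inverse of
    [phi]. Let [x] lie in the approach region at [zeta]. The mean value
    inequality on [B(x, delta x / 3)], on which [delta] is comparable to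
    [delta x], bounds [delta x ^ (n + gamma) * u x] by a constant times the
    integral of [delta ^ gamma * u] over that ball ([weighted_mean_value]). The
    ball lies in the strip where [delta < 4 / 3 * rho]. It remains to see how
    far the points of the ball are from [zeta]. Since [zeta] is a boundary
    point, [delta x <= |x - zeta|], and membership in the approach region says
    [|x - zeta| < psi (alpha * delta x)], which by the doubling property of
    [psi] is at most a constant times [psi (delta x)]; so every point [y] of
    the ball is within a constant times [psi (delta y)] of [zeta]
    ([approach_whitney]).

    The supremum at [zeta] is therefore at most a constant times the integral
    over the [y] of the strip with [|y - zeta| <= A psi (delta y)] of
    [delta y ^ gamma * u y * psi (delta y) ^ (- d)]. Integrating in [zeta] and
    exchanging the integrals leaves, for each [y], the Hausdorff measure of the
    part of the boundary within [A psi (delta y)] of [y], which by Ahlfors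
    regularity is at most a constant times [psi (delta y) ^ d]
    ([hausdorff_eball_le]). The two powers of [psi] cancel.

    The exchange is carried out discretely. The domain is partitioned into
    countably many pieces, each so small compared with its distance to the
    boundary that [delta] and [psi \o delta] may be replaced by their values
    at one point [q j] ([whitney_partition]). The supremum is then dominated by
    a series of multiples of indicators of balls centred at the [q j], which is
    integrated term by term ([integral_le_series_indic]); the supremum itself,
    whose measurability in [zeta] is not clear, is only ever bounded above.

    All this presupposes that open sets are measurable. For the Hausdorff
    measure this is Carathéodory's criterion for metric outer measures
    ([caratheodory_sublevel]); for the Lebesgue measure it follows from the
    additivity of the volume of a box cut by a hyperplane
    ([lebesgue_measurable_half_space]). *)

(** * Euclidean norm and Euclidean balls *)

Section euclidean_norm.
Context {R : realType} {n : nat}.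
Implicit Types (x y z : 'rV[R]_n) (r : R).

Lemma sum_sqr_ge0 x : 0 <= \sum_(i < n) x ord0 i ^+ 2.
Proof. by apply: sumr_ge0 => i _; exact: sqr_ge0. Qed.

Lemma enorm_ge0 x : 0 <= enorm x.
Proof. exact: sqrtr_ge0. Qed.

Lemma sqr_enorm x : enorm x ^+ 2 = \sum_(i < n) x ord0 i ^+ 2.
Proof. by rewrite sqr_sqrtr// sum_sqr_ge0. Qed.

Lemma enormN x : enorm (- x) = enorm x.
Proof.
by congr Num.sqrt; apply: eq_bigr => i _; rewrite mxE sqrrN.
Qed.

Lemma enormB x y : enorm (x - y) = enorm (y - x).
Proof. by rewrite -enormN opprB. Qed.

Lemma enorm0 : enorm (0 : 'rV[R]_n) = 0.
Proof. by rewrite /enorm big1 ?sqrtr0// => i _; rewrite mxE expr0n. Qed.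

Lemma enormZ (a : R) x : enorm (a *: x) = `|a| * enorm x.
Proof.
rewrite /enorm -sqrtr_sqr -sqrtrM ?sqr_ge0// mulr_sumr; congr Num.sqrt.
by apply: eq_bigr => i _; rewrite mxE exprMn.
Qed.

Lemma sum_cauchy_schwarz (a b : 'I_n -> R) :
  (\sum_i a i * b i) ^+ 2 <= (\sum_i a i ^+ 2) * (\sum_i b i ^+ 2).
Proof.
have : 0 <= \sum_i \sum_j (a i * b j - a j * b i) ^+ 2.
  by apply: sumr_ge0 => i _; apply: sumr_ge0 => j _; exact: sqr_ge0.
have -> : \sum_i \sum_j (a i * b j - a j * b i) ^+ 2 =
    (\sum_i a i ^+ 2) * (\sum_i b i ^+ 2) +
    (\sum_i b i ^+ 2) * (\sum_i a i ^+ 2) - 2 * (\sum_i a i * b i) ^+ 2.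
  rewrite expr2 !big_distrlr/= mulr_sumr -big_split/= -sumrB.
  apply: eq_bigr => i _; rewrite mulr_sumr -big_split/= -sumrB.
  by apply: eq_bigr => j _; ring.
by move=> h; nra.
Qed.

Lemma enormD x y : enorm (x + y) <= enorm x + enorm y.
Proof.
rewrite -(@ler_pXn2r _ 2)// ?nnegrE ?addr_ge0 ?enorm_ge0//.
have -> : enorm (x + y) ^+ 2 =
    enorm x ^+ 2 + enorm y ^+ 2 + 2 * \sum_i x ord0 i * y ord0 i.
  rewrite !sqr_enorm mulr_sumr -!big_split/=.
  by apply: eq_bigr => i _; rewrite mxE; ring.
have cs : \sum_i x ord0 i * y ord0 i <= enorm x * enorm y.
  rewrite (le_trans (ler_norm _))// -sqrtr_sqr -sqrtrM ?sum_sqr_ge0//.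
  by rewrite ler_wsqrtr// sum_cauchy_schwarz.
by rewrite sqrrD; move: cs; lra.
Qed.

Lemma enorm_triangle y x z : enorm (x - z) <= enorm (x - y) + enorm (y - z).
Proof. by rewrite (le_trans _ (enormD _ _))// addrA subrK. Qed.

Lemma coord_le_enorm x i : `|x ord0 i| <= enorm x.
Proof.
rewrite -sqrtr_sqr ler_wsqrtr// (bigD1 i)//= lerDl.
by apply: sumr_ge0 => j _; exact: sqr_ge0.
Qed.

Lemma enorm_le_coord x r : (forall i, `|x ord0 i| <= r) -> enorm x <= n%:R * r.
Proof.
move=> xr; have [n0|n_gt0] := posnP n.
  rewrite /enorm big1 ?sqrtr0; last first.
    by move=> i _; exfalso; move: (ltn_ord i); rewrite [X in (_ < X)%N]n0.
  by rewrite [in leRHS]n0 mul0r.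
have r0 : 0 <= r by exact: le_trans (xr (Ordinal n_gt0)).
rewrite -(@ler_pXn2r _ 2)// ?nnegrE ?mulr_ge0 ?enorm_ge0// sqr_enorm.
apply: (@le_trans _ _ (\sum_(i < n) r ^+ 2)).
  by apply: ler_sum => i _; rewrite -real_normK ?num_real// ler_pXn2r ?nnegrE.
rewrite sumr_const card_ord -[r ^+ 2 *+ n]mulr_natl exprMn ler_wpM2r ?sqr_ge0//.
by rewrite -natrX ler_nat -mulnn leq_pmull.
Qed.

End euclidean_norm.

Section euclidean_topology.
Context {R : realType} {n : nat}.
Implicit Types (x y z : 'rV[R]_n) (r : R) (D : set 'rV[R]_n).

Lemma eball_center x r : 0 < r -> eball x r x.
Proof. by rewrite /eball/= subrr enorm0. Qed.

Lemma open_eballP D :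
  open D <-> forall x, D x -> exists2 e, 0 < e & eball x e `<=` D.
Proof.
split=> [oD x Dx|h].
  have /nbhs_ballP[e /= e0 eD] : nbhs x D by apply: open_nbhs_nbhs.
  exists e => // y xy; apply: eD; split=> // i j; rewrite ord1 /ball/=.
  apply: le_lt_trans xy; rewrite enormB.
  by have := coord_le_enorm (x - y) j; rewrite !mxE.
rewrite openE => x /h[e e0 eD]; apply/nbhs_ballP.
have n1 : 0 < n.+1%:R :> R by rewrite ltr0n.
exists (e / n.+1%:R) => /=; first by rewrite divr_gt0.
move=> y [_ xy]; apply: eD; rewrite /eball/= enormB.
have := @enorm_le_coord _ _ (x - y) (e / n.+1%:R).
move=> /(_ _)/le_lt_trans; apply.
  by move=> i; have := xy ord0 i; rewrite /ball/= !mxE => /ltW.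
by rewrite mulrCA gtr_pMr// ltr_pdivrMr// mul1r ltr_nat.
Qed.

Lemma open_eball x r : open (eball x r).
Proof.
apply/open_eballP => y xy; exists (r - enorm (y - x)).
  by rewrite subr_gt0.
move=> z yz; have := enorm_triangle y z x.
by rewrite /eball/= in yz *; move: xy yz; rewrite /eball/=; lra.
Qed.

Definition rat_point (v : 'rV[rat]_n) : 'rV[R]_n := map_mx ratr v.

Lemma rat_point_dense x r : 0 < r -> exists v, enorm (x - rat_point v) < r.
Proof.
move=> r0; have n1 : 0 < n.+1%:R :> R by rewrite ltr0n.
have h i : exists q : rat, `|x ord0 i - ratr q| <= r / n.+1%:R.
  have re : 0 < r / n.+1%:R by rewrite divr_gt0.
  have [|q] := @rat_in_itvoo R (x ord0 i) (x ord0 i + r / n.+1%:R).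
    by rewrite ltrDl.
  rewrite in_itv/= => /andP[q1 q2]; exists q; rewrite ler_norml.
  by move: re q1 q2; set e := r / _ => *; apply/andP; split; lra.
have [q qP] := choice h.
exists (\row_i q i); apply: (@le_lt_trans _ _ (n%:R * (r / n.+1%:R))).
  by apply: enorm_le_coord => i; rewrite !mxE.
by rewrite mulrCA gtr_pMr// ltr_pdivrMr// mul1r ltr_nat.
Qed.

End euclidean_topology.

(** * Carathéodory's criterion for outer measures additive on separated sets *)

Section separated_level_sets.
Local Open Scope ereal_scope.
Context {R : realType} {T : Type}.
Variables (mu : {outer_measure set T -> \bar R}) (g : T -> R).
Hypothesis mu_sep : forall (s t : R) (A B : set T), (s < t)%R ->
  (forall x, A x -> g x <= s)%R -> (forall x, B x -> t <= g x)%R ->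
  mu A + mu B <= mu (A `|` B).

Let level k : R := (k.+1%:R)^-1.

Let level_gt0 k : (0 < level k)%R.
Proof. by rewrite invr_gt0 ltr0n. Qed.

Let ltr_level k l : (k < l)%N -> (level l < level k)%R.
Proof. by move=> kl; rewrite ltf_pV2 ?posrE ?ltr0n// ltr_nat ltnS. Qed.

Let above A k : set T := A `&` [set x | level k < g x]%R.

Let shell A k : set T := A `&` [set x | level k.+2 < g x <= level k.+1]%R.

(* [b] is 0 or 1 and selects the even or the odd shells. *)
Let sum_shell_parity A b N :
  \sum_(0 <= k < N) mu (shell A (k.*2 + b)%N) <= mu (above A (N.*2 + b)%N).
Proof.
elim: N => [|N ih]; first by rewrite big_nil outer_measure_ge0.
rewrite big_nat_recr//= addeC; apply: le_trans (leeD2l _ ih) _.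
apply: (@le_trans _ _ (mu (shell A (N.*2 + b)%N `|` above A (N.*2 + b)%N))).
  apply: (mu_sep (@ltr_level (N.*2 + b)%N _ (ltnSn _))).
    by move=> x [_ /andP[]].
  by move=> x [_ /ltW].
apply: le_outer_measure => x; rewrite doubleS !addSn => -[[Ax /andP[h _]]|[Ax h]].
  by split.
by split => //; apply: le_lt_trans h; apply/ltW/ltr_level; rewrite ltnS leqnSn.
Qed.

Let series_shell_le A : \sum_(0 <= k <oo) mu (shell A k) <= mu A + mu A.
Proof.
apply: lime_le.
  by apply: is_cvg_nneseries => k _ _; exact: outer_measure_ge0.
apply: nearW => N.
have even_odd M : \sum_(0 <= k < M.*2) mu (shell A k) =
    \sum_(0 <= k < M) mu (shell A (k.*2 + 0)%N) +
    \sum_(0 <= k < M) mu (shell A (k.*2 + 1)%N).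
  elim: M => [|M ih]; first by rewrite !big_nil adde0.
  rewrite doubleS !big_nat_recr//= ih addn0 addn1.
  by rewrite -!addeA; congr (_ + _); rewrite addeCA.
apply: (@le_trans _ _ (\sum_(0 <= k < N.*2) mu (shell A k))).
  rewrite (@big_cat_nat _ _ _ N 0 N.*2)//= -?addnn ?leq_addr// leeDl//.
  by apply: sume_ge0 => k _; exact: outer_measure_ge0.
rewrite even_odd leeD// (le_trans (sum_shell_parity _ _ _))//.
all: by apply: le_outer_measure => x [].
Qed.

(** Carathéodory's criterion, for the sublevel set of one function. Separation
    gives the inequality with the points where [level N < g] in place of those
    where [0 < g]. The points in between lie in shells. Shells two steps apart
    are separated, so the measures of the even ones and those of the odd ones
    each sum to at most [mu A]; hence the points left out contribute at most
    the tail of a convergent series. *)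
Lemma caratheodory_sublevel : mu.-caratheodory [set x | g x <= 0]%R.
Proof.
apply: le_caratheodory_measurable => A.
have [->|Afin] := eqVneq (mu A) +oo; first by rewrite leey.
have {}Afin : mu A < +oo by rewrite ltey.
set P := A `&` _; set N := A `&` _.
have tail0 : mu A + \sum_(M <= k <oo) mu (shell A k) @[M --> \oo] --> mu A.
  rewrite -[X in _ --> X]adde0; apply: cvgeD => //.
  - by rewrite fin_num_adde_defl.
  - exact: cvg_cst.
  - apply: nneseries_tail_cvg => [|k _]; last exact: outer_measure_ge0.
    apply: le_lt_trans (series_shell_le A) _; exact: lte_add_pinfty.
apply: (cvge_ge _ tail0); apply: nearW => M.
have NM : mu N <= mu (above A M.+1) + \sum_(M <= k <oo) mu (shell A k).
  apply: le_trans (leeD2l _ (outer_measure_sigma_subadditive_tail _ _ _)).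
  apply: le_trans (outer_measureU2 _ _ _); apply: le_outer_measure => x [Ax /negP].
  rewrite -ltNge => gx0; have [gx|gx] := ltP (level M.+1) (g x); first by left.
  (* The shell of [x] is found from the first level below [g x]. *)
  right; pose h k := (level k < g x)%R.
  have [k0 hk0] : exists k, h k.
    exists (Num.truncn (g x)^-1); rewrite /h invf_plt ?posrE ?ltr0n//.
    by rewrite truncnS_gt.
  have [m hm mmin] := ex_minnP (ex_intro h k0 hk0).
  have Mm : (M.+1 < m)%N.
    rewrite ltnNge; apply/negP => mM; move: hm; rewrite /h ltNge => /negP; apply.
    rewrite (le_trans gx)//; move: mM; rewrite leq_eqVlt => /predU1P[->//|].
    by move/ltr_level/ltW.
  case: m => [//|[//|m]] in hm mmin Mm *; exists m.
    by rewrite /= ltnNge; apply/negP/negPn.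
  split=> //=; apply/andP; split; first exact: hm.
  rewrite leNgt; apply/negP => /mmin.
  by rewrite ltnn.
rewrite (le_trans (leeD2l _ NM))// addeA leeD2r//.
apply: le_trans (mu_sep (level_gt0 M.+1) _ _) _.
- by move=> x [].
- by move=> x [_ /ltW].
- by apply: le_outer_measure => x [[]|[]].
Qed.

End separated_level_sets.

(** * Hausdorff measurability of open sets *)

Section countable_subadditivity.
Context {R : realType} {T : Type} {X : choiceType}.
Variable mu : {outer_measure set T -> \bar R}.

Lemma outer_measure_countable_bigcup (Q : set X) (F : X -> set T) :
  countable Q ->
  (mu (\bigcup_(q in Q) F q) <= \esum_(q in Q) mu (F q))%E.
Proof.
move=> /countable_injP[f finj].
pose B k := \bigcup_(q in Q `&` f @^-1` [set k]) F q.
have BE q : Q q -> B (f q) = F q.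
  move=> Qq; apply/seteqP; split => [x [p [Qp /finj]]|x Fqx]; last by exists q.
  by rewrite !inE => /(_ Qp Qq) ->.
apply: (@le_trans _ _ (\sum_(k <oo) mu (B k))%E).
  apply: le_trans (outer_measure_sigma_subadditive _ _).
  by apply: le_outer_measure => x [q Qq Fqx]; exists (f q) => //; exists q.
(* Indices outside [f @` Q] contribute empty sets. *)
rewrite nneseries_esumT; last by move=> k; exact: outer_measure_ge0.
rewrite (esumID (f @` Q))//; last by move=> *; exact: outer_measure_ge0.
rewrite setTI setTI [X in (_ + X)%E]esum1 ?adde0; last first.
  move=> k /= fk; rewrite /B bigcup0 ?outer_measure0// => q [Qq fq].
  by case: fk; exists q.
rewrite esum_image; last by move=> p q Qp Qq /finj; exact.
by apply: le_esum => q Qq; rewrite BE.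
Qed.

(** A cover of [A] cut along [H] covers the two halves of [A], so for an outer
    measure built from covers Carathéodory's condition need only be tested on
    the covering sets. *)
Lemma cover_outer_caratheodory (P : set X) (S : X -> set T) (w : X -> \bar R)
    (H : set T) :
  (forall A, mu A = cover_outer P S w A) ->
  (forall q, P q -> (mu (S q `&` H) + mu (S q `&` ~` H) <= w q)%E) ->
  mu.-caratheodory H.
Proof.
move=> muE test; apply: le_caratheodory_measurable => A; rewrite [leRHS]muE.
apply: le_ereal_inf_tmp => _ [Q [cQ QP AQ] <-].
have cut E : (mu (A `&` E) <= \esum_(q in Q) mu (S q `&` E))%E.
  apply: le_trans (outer_measure_countable_bigcup _ cQ).
  by apply: le_outer_measure => x [/AQ[q Qq Sqx] Ex]; exists q.
apply: le_trans (leeD (cut _) (cut _)) _.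
rewrite -esumD; first by apply: le_esum => q /QP; exact: test.
all: by move=> *; exact: outer_measure_ge0.
Qed.

End countable_subadditivity.

Section open_sets_from_balls.
Context {R : realType} {n : nat}.
Variable mu : {outer_measure set 'rV[R]_n -> \bar R}.

(** Every open set is the union of the balls of radius [1/(k+1)] with rational
    centre that it contains. *)
Lemma caratheodory_open (D : set 'rV[R]_n) :
  (forall x r, mu.-caratheodory (eball x r)) -> open D ->
  mu.-cara.-measurable D.
Proof.
move=> mball oD.
pose F (p : 'rV[rat]_n * nat) : set 'rV[R]_n :=
  eball (rat_point p.1) p.2.+1%:R^-1.
pose G p : set (caratheodory_type mu) := [set x | F p x /\ F p `<=` D].
have -> : D = \bigcup_p G p.
  apply/seteqP; split => [x Dx|x [p _ [Fpx]]]; last exact.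
  have [e e0 xeD] := (open_eballP D).1 oD x Dx.
  pose k := Num.truncn (2 / e).
  have k0 : 0 < k.+1%:R :> R by rewrite ltr0n.
  have ke : 2 * k.+1%:R^-1 < e.
    have e2 : 2 / e < k.+1%:R by exact: truncnS_gt.
    by rewrite ltr_pdivrMr// mulrC -ltr_pdivrMr.
  have ki : 0 < k.+1%:R^-1 :> R by rewrite invr_gt0.
  have [v xv] := rat_point_dense x ki; exists (v, k) => //; split => //.
  move=> y vy; apply: xeD; have := enorm_triangle (rat_point v) y x.
  move: vy ke xv; rewrite (enormB x) /F /eball/=; set i := k.+1%:R^-1.
  by move=> *; lra.
apply: countable_bigcupT_measurable => [|p]; first exact: countableP.
have [FD|FD] := pselect (F p `<=` D).
  rewrite (_ : G p = F p); last by apply/seteqP; split => [x []|x].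
  exact: mball.
rewrite (_ : G p = set0); first exact: measurable0.
by apply/seteqP; split => // x [].
Qed.

End open_sets_from_balls.

Section hausdorff_open.
Context {R : realType} {n : nat} (d : R).
Implicit Types (A B : set 'rV[R]_n) (g : 'rV[R]_n -> R).

Lemma hausdorff_content_anti (e1 e2 : R) A : e1 <= e2 ->
  (hausdorff_content d e2 A <= hausdorff_content d e1 A)%E.
Proof.
move=> e12; apply: ereal_inf_le_tmp => _ [Q [cQ QP AQ] <-].
exists Q => //; split => // U /QP /= /le_trans; apply.
by rewrite lee_fin.
Qed.

(** A set of diameter less than [t - s] cannot meet both [A] and [B], so a
    cover of the union falls apart into disjoint covers of [A] and [B]. *)
Lemma hausdorff_content_separated g (s t e : R) A B :
  (forall x y, g x <= g y + enorm (x - y)) -> e < t - s ->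
  (forall x, A x -> g x <= s) -> (forall x, B x -> t <= g x) ->
  (hausdorff_content d e A + hausdorff_content d e B <=
   hausdorff_content d e (A `|` B))%E.
Proof.
move=> glip est As Bt; apply: le_ereal_inf_tmp => _ [Q [cQ QP ABQ] <-].
pose meets C : set (set 'rV[R]_n) := [set U | U `&` C !=set0].
have w0 (U : set 'rV[R]_n) : (0 <= poweR (ediam U) d)%E by exact: poweR_ge0.
have content_le C : C `<=` A `|` B ->
    (hausdorff_content d e C <= \esum_(U in Q `&` meets C) poweR (ediam U) d)%E.
  move=> CAB; apply: ereal_inf_lbound; exists (Q `&` meets C) => //; split.
  - by apply: sub_countable cQ; apply: subset_card_le; exact: subIsetl.
  - by move=> U [/QP].
  - move=> x Cx; have [U QU Ux] := ABQ _ (CAB _ Cx); exists U => //.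
    by split=> //; exists x.
rewrite (esumID (meets A))//; apply: leeD.
  by apply: content_le; exact: subsetUl.
apply: le_trans (content_le B _) _; first exact: subsetUr.
apply: esum_subset_le => // U [QU [y [Uy By]]]; split=> // -[x [Ux Ax]].
have xy : ((enorm (y - x))%:E <= e%:E)%E.
  apply: le_trans (QP _ QU); rewrite /ediam le_max; apply/orP; right.
  by apply: ereal_sup_ubound; exists y, x.
rewrite lee_fin in xy; have := glip y x; have := As _ Ax; have := Bt _ By.
by move: xy est; lra.
Qed.

Lemma hausdorff_outer_separated g (s t : R) A B :
  (forall x y, g x <= g y + enorm (x - y)) -> s < t ->
  (forall x, A x -> g x <= s) -> (forall x, B x -> t <= g x) ->
  (hausdorff_outer d A + hausdorff_outer d B <= hausdorff_outer d (A `|` B))%E.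
Proof.
move=> glip st As Bt; set L := hausdorff_outer d (A `|` B).
(* Both contents increase when the two scales are lowered to a common one that
   is smaller than the gap between [A] and [B]. *)
have contents e1 e2 : 0 < e1 -> 0 < e2 ->
    (hausdorff_content d e1 A + hausdorff_content d e2 B <= L)%E.
  move=> e10 e20; pose e := Num.min (Num.min e1 e2) ((t - s) / 2).
  have e0 : 0 < e by rewrite !lt_min e10 e20/=; lra.
  apply: le_trans (le_hausdorff_outer d (A `|` B) e0).
  apply: le_trans (hausdorff_content_separated (e := e) glip _ As Bt).
    by apply: leeD; apply: hausdorff_content_anti; rewrite !ge_min lexx ?orbT.
  by rewrite /e gt_min; apply/orP; right; lra.
have [->|Lfin] := eqVneq L +oo%E; first by rewrite leey.
have {}Lfin : L \is a fin_num.
  by rewrite ge0_fin_numE ?hausdorff_outer_ge0// ltey.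
have fin (x : \bar R) : (0 <= x <= L)%E -> x \is a fin_num.
  move=> /andP[x0 xL]; rewrite ge0_fin_numE//.
  by rewrite (le_lt_trans xL)// ltey_eq Lfin.
have finout C : C `<=` A `|` B -> hausdorff_outer d C \is a fin_num.
  move=> CAB; apply: fin; rewrite hausdorff_outer_ge0/=.
  exact: homo_hausdorff_outer.
have finB : hausdorff_outer d B \is a fin_num.
  by apply: finout; exact: subsetUr.
rewrite -leeBrDr//; apply: ge_ereal_sup => _ [e1 e10 <-].
have fin1 : hausdorff_content d e1 A \is a fin_num.
  apply: fin; apply/andP; split.
    by apply: cover_outer_ge0 => U _; exact: poweR_ge0.
  apply: le_trans (le_hausdorff_outer d A e10) _.
  by apply: homo_hausdorff_outer; exact: subsetUl.
rewrite leeBrDr// addeC -leeBrDr//; apply: ge_ereal_sup => _ [e2 e20 <-].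
by rewrite leeBrDr// addeC; exact: contents.
Qed.

(** Balls are obtained with [g] the distance to the centre, up to sign. *)
Lemma hausdorff_caratheodory_sublevel g (r : R) :
  (forall x y, g x <= g y + enorm (x - y)) ->
  (@hausdorff_outer R n d).-cara.-measurable [set x | g x <= r].
Proof.
move=> glip.
rewrite (_ : mkset _ = [set x | (g \- cst r) x <= 0]); last first.
  by apply/seteqP; split => x /=; rewrite subr_le0.
apply: caratheodory_sublevel => s t A B st As Bt.
apply: (hausdorff_outer_separated (g := g \- cst r) (s := s) (t := t)) => //.
by move=> x y /=; have := glip x y; lra.
Qed.

Lemma hausdorff_measurable_ball x r :
  (@hausdorff_outer R n d).-cara.-measurable (eball x r).
Proof.
rewrite (_ : eball x r = ~` [set y | - enorm (y - x) <= - r]).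
  apply/measurableC/hausdorff_caratheodory_sublevel => y z.
  by have := enorm_triangle y z x; rewrite (enormB z y); lra.
apply/seteqP; split => y; rewrite /eball/= lerN2.
  by move=> h; apply/negP; rewrite -ltNge.
by move=> /negP; rewrite -ltNge.
Qed.

Lemma hausdorff_measurable_open D : open D ->
  (@hausdorff_outer R n d).-cara.-measurable D.
Proof.
by apply: caratheodory_open => x r; exact: hausdorff_measurable_ball.
Qed.

End hausdorff_open.

(** * Lebesgue measurability of open sets *)

Lemma measurable_fun_rays d (T : measurableType d) (R : realType) (D : set T)
    (f : T -> R) :
  (forall r, measurable (D `&` [set x | f x < r])) -> measurable_fun D f.
Proof.
move=> h; apply: (measurability _ (RGenInftyO.measurableE R)).
move=> _ [_ [r ->] <-]; rewrite (_ : f @^-1` _ = [set x | f x < r])//.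
Qed.

Section lebesgue_open.
Context {R : realType} {n : nat}.
Local Notation leb_outer := (@lebesgue_outer R n).
Local Notation lebT := (caratheodory_type (@lebesgue_outer R n)).

Lemma lebesgue_outer_box (q : 'rV[R]_n * 'rV[R]_n) :
  proper_box q -> (lebesgue_outer (box q) <= box_volume q)%E.
Proof.
move=> pq; apply: ereal_inf_lbound; exists [set q].
  split; [exact: finite_set_countable|by move=> _ ->|by move=> x qx; exists q].
by rewrite esum_set1// box_volume_ge0.
Qed.

(** Cutting a box by a coordinate hyperplane yields two boxes whose volumes add
    up to that of the box; [c] is the height of the cut, moved inside the box
    when the hyperplane misses it. *)
Lemma lebesgue_measurable_half_space i (t : R) :
  leb_outer.-cara.-measurable [set x : 'rV[R]_n | x ord0 i <= t].
Proof.
apply: (@cover_outer_caratheodory _ _ _ _ proper_box box box_volume) => //.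
move=> [a b] /= ab; set H := mkset _.
pose c := Num.max (a ord0 i) (Num.min t (b ord0 i)).
have ac : a ord0 i <= c by rewrite le_max lexx.
have cb : c <= b ord0 i by rewrite ge_max ab ge_min lexx orbT.
pose b' : 'rV[R]_n := \row_j if j == i then c else b ord0 j.
pose a' : 'rV[R]_n := \row_j if j == i then c else a ord0 j.
have pab' : proper_box (a, b').
  by move=> j; rewrite /= mxE; case: eqP => [->//|_]; exact: ab.
have pa'b : proper_box (a', b).
  by move=> j; rewrite /= mxE; case: eqP => [->//|_]; exact: ab.
apply: (@le_trans _ _ (box_volume (a, b') + box_volume (a', b))%E).
  apply: leeD; (apply: le_trans (lebesgue_outer_box _) => //;
      apply: le_outer_measure => x [xab Hx] j; have /andP[ax xb] := xab j).
    rewrite /= mxE ax/=; case: eqP => // ji; subst j.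
    by rewrite le_max le_min Hx xb orbT.
  rewrite /= mxE xb andbT; case: eqP => // ji; subst j.
  by move: Hx => /negP; rewrite -ltNge => /ltW tx; rewrite ge_max ax ge_min tx.
rewrite /box_volume/= -EFinD lee_fin (bigD1 i)//= [X in _ + X](bigD1 i)//=.
rewrite [leRHS](bigD1 i)//= !mxE eqxx.
rewrite (eq_bigr (fun j => b ord0 j - a ord0 j)); last first.
  by move=> j /negbTE ji; rewrite mxE ji.
rewrite [X in _ + _ * X](eq_bigr (fun j => b ord0 j - a ord0 j)); last first.
  by move=> j /negbTE ji; rewrite mxE ji.
by rewrite -mulrDl addrC addrA subrK.
Qed.

Lemma lebesgue_measurable_coord i :
  measurable_fun setT (fun x : lebT => (x : 'rV[R]_n) ord0 i).
Proof.
apply: (measurability _ (RGenOInfty.measurableE R)) => _ [_ [r ->] <-].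
rewrite setTI (_ : _ @^-1` _ = ~` [set x : 'rV[R]_n | x ord0 i <= r]).
  exact/measurableC/lebesgue_measurable_half_space.
apply/seteqP; split => x /=; rewrite in_itv/= andbT ltNge; first by move/negP.
by move=> /negP.
Qed.

Lemma lebesgue_measurable_ball (x : 'rV[R]_n) r :
  leb_outer.-cara.-measurable (eball x r).
Proof.
have mf : measurable_fun setT (fun y : lebT => enorm ((y : 'rV[R]_n) - x)).
  have msqrt := continuous_measurable_fun (@sqrt_continuous R).
  rewrite /enorm; apply: (measurableT_comp msqrt) => //.
  apply: measurable_sum => i; apply: measurable_funX.
  under eq_fun do rewrite !mxE.
  by apply: measurable_funD => //; exact: lebesgue_measurable_coord.
have := mf measurableT `]-oo, r[%classic (measurable_itv _).
rewrite setTI; congr measurable.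
Qed.

Lemma lebesgue_measurable_open D : open D -> leb_outer.-cara.-measurable D.
Proof.
by apply: caratheodory_open => x r; exact: lebesgue_measurable_ball.
Qed.

End lebesgue_open.

(** * Distance to the boundary, and the inverse of an admissible function *)

Section boundary_distance.
Context {R : realType} {n : nat}.
Variable D : set 'rV[R]_n.
Hypothesis oD : open D.
Implicit Types (x y z : 'rV[R]_n).
Local Notation delta := (bdist D).

Lemma boundary_notin z : boundary D z -> ~ D z.
Proof. by move=> [_ +] Dz; apply; move: oD; rewrite openE; exact. Qed.

(** If a segment leaving the open set [D] avoided the boundary, the parameters
    of its points in [D] and in the closure of [D] would be the same, hence
    form a clopen part of [0, 1]. *)
Lemma segment_meets_boundary x y : D x -> ~ D y ->
  exists2 z, boundary D z & enorm (x - z) <= enorm (x - y).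
Proof.
move=> Dx Dy; apply: contrapT => noz.
pose f (t : R) : 'rV[R]_n := x + t *: (y - x).
have cf : continuous f.
  move=> t; apply: cvgD; first exact: cvg_cst.
  by apply: cvgZr_tmp; exact: cvg_id.
have fbd t : 0 <= t <= 1 -> ~ boundary D (f t).
  move=> /andP[t0 t1] bt; apply: noz; exists (f t) => //.
  rewrite /f opprD addrA subrr add0r enormN enormZ (enormB y).
  by rewrite ger0_norm// ler_piMl// enorm_ge0.
have seg : connected (`[0, 1]%classic : set R) by exact: segment_connected.
have /seteqP[_ /(_ 1)] : `[0, 1]%classic `&` f @^-1` D = `[0, 1]%classic.
  apply: seg.
  - by exists 0; split; rewrite /= ?in_itv/= ?lexx ?ler01// /f scale0r addr0.
  - by exists (f @^-1` D) => //; apply: open_comp => // t _; exact: cf.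
  - exists (f @^-1` closure D).
      by apply: closed_comp; [move=> t _; exact: cf|exact: closed_closure].
    apply/seteqP; split => t [t01 Dft]; split=> //; first exact: subset_closure.
    apply: contrapT => nD; apply: (fbd t); first by move: t01; rewrite /= in_itv.
    by split => // /interior_subset.
rewrite /= in_itv/= ler01 lexx => /(_ isT)[_].
by rewrite /f scale1r addrC subrK.
Qed.

Let dists x := [set enorm (x - z) | z in boundary D].

Let has_lbound_dists x : has_lbound (dists x).
Proof. by exists 0 => _ [z _ <-]; exact: enorm_ge0. Qed.

Lemma bdist_le x z : boundary D z -> delta x <= enorm (x - z).
Proof. by move=> bz; apply: (ge_inf (has_lbound_dists x)); exists z. Qed.

(** When the boundary is empty, [delta] is constantly 0. *)
Lemma bdist_lip x y : delta x <= delta y + enorm (x - y).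
Proof.
have [[z0 bz0]|nb] := pselect (boundary D !=set0); last first.
  have E w : delta w = 0.
    rewrite /bdist (_ : boundary D = set0) ?image_set0 ?inf0//.
    by apply/seteqP; split => // z bz; apply: nb; exists z.
  by rewrite !E add0r enorm_ge0.
rewrite -lerBlDr; apply: lb_le_inf; first by exists (enorm (y - z0)); exists z0.
move=> _ [z bz <-]; have := bdist_le x bz; have := enorm_triangle y x z.
by lra.
Qed.

Lemma open_bdist_lt (r : R) : open [set x | delta x < r].
Proof.
apply/open_eballP => x /= xr; exists (r - delta x); first by rewrite subr_gt0.
by move=> y; rewrite /eball/= => xy; have := bdist_lip y x; lra.
Qed.

Lemma eball_bdist x y : D x -> enorm (y - x) < delta x -> D y.
Proof.
move=> Dx yx; apply: contrapT => Dy.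
have [z bz] := segment_meets_boundary Dx Dy.
by have := bdist_le x bz; rewrite (enormB x y); lra.
Qed.

Lemma boundary_nonempty : D !=set0 -> D <> setT -> boundary D !=set0.
Proof.
move=> [x Dx] DT; apply: contrapT => nb; apply: DT; apply/seteqP; split=> // y _.
apply: contrapT => Dy; have [z bz _] := segment_meets_boundary Dx Dy.
by apply: nb; exists z.
Qed.

Lemma bdist_gt0 x : boundary D !=set0 -> D x -> 0 < delta x.
Proof.
move=> [z0 bz0] Dx; have [e e0 xeD] := (open_eballP D).1 oD x Dx.
apply: (lt_le_trans e0); apply: lb_le_inf.
  by exists (enorm (x - z0)); exists z0.
move=> _ [z bz <-]; rewrite leNgt; apply/negP => xz.
by apply: (boundary_notin bz); apply: xeD; rewrite /eball/= enormB.
Qed.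

End boundary_distance.

Section half_line_inverse.
Context {R : realType}.
Variables (phi : R -> R) (C0 r0 : R).
Hypothesis adm : admissible phi C0 r0.
Local Notation psi := (half_line_inv phi).

Let C0_ge1 : 1 <= C0. Proof. by have [[]] := adm. Qed.

Let phi_homo : {in `[0, +oo[ &, {homo phi : s t / s < t}}.
Proof. by have [_] := adm. Qed.

Let phi_range : phi @` `[0, +oo[%classic = `[0, +oo[%classic.
Proof. by have [_ _] := adm. Qed.

Let phi_inj : {in (`[0, +oo[%classic : set R) &, injective phi}.
Proof.
move=> s t; rewrite !inE => s0 t0 st; apply/eqP/negPn/negP.
by rewrite neq_lt => /orP[/(phi_homo s0 t0)|/(phi_homo t0 s0)]; rewrite st ltxx.
Qed.

Lemma half_line_inv_ge0 s : 0 <= s -> 0 <= psi s.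
Proof.
move=> s0; have : (psi @` (phi @` `[0, +oo[%classic)) (psi s).
  by exists s => //; rewrite phi_range /= in_itv/= s0.
by rewrite /half_line_inv (injpinv_image _ phi_inj) /= in_itv/= andbT.
Qed.

Lemma half_line_invK s : 0 <= s -> phi (psi s) = s.
Proof.
by move=> s0; apply: pinvK; rewrite inE phi_range /= in_itv/= s0.
Qed.

Lemma half_line_invKV t : 0 <= t -> psi (phi t) = t.
Proof.
by move=> t0; apply: (pinvKV _ phi_inj); rewrite inE /= in_itv/= t0.
Qed.

Lemma admissible_ge0 t : 0 <= t -> 0 <= phi t.
Proof.
move=> t0; have : (phi @` `[0, +oo[%classic) (phi t).
  by exists t => //=; rewrite in_itv/= t0.
by rewrite phi_range /= in_itv/= andbT.
Qed.

Lemma ltr_half_line_inv s t : 0 <= s -> s < t -> psi s < psi t.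
Proof.
move=> s0 st; have t0 := le_lt_trans s0 st.
rewrite ltNge; apply/negP; rewrite le_eqVlt => /predU1P[E|].
  by move: st; rewrite -(half_line_invK s0) -(half_line_invK (ltW t0)) E ltxx.
move=> /phi_homo; rewrite !in_itv/= !half_line_inv_ge0 ?(ltW t0)// => /(_ isT isT).
by rewrite !half_line_invK ?(ltW t0)// ltNge (ltW st).
Qed.

Lemma ler_half_line_inv s t : 0 <= s -> s <= t -> psi s <= psi t.
Proof.
by move=> s0; rewrite le_eqVlt => /predU1P[->//|/(ltr_half_line_inv s0)/ltW].
Qed.

Lemma half_line_inv_gt0 s : 0 < s -> 0 < psi s.
Proof.
by move=> s0; rewrite (le_lt_trans (half_line_inv_ge0 (lexx 0)))// ltr_half_line_inv.
Qed.

Lemma half_line_inv_double s : 0 <= s <= r0 -> psi (2 * s) <= C0 * psi s.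
Proof. by have [_ _ _ _] := adm; exact. Qed.

Lemma half_line_inv_exp2 k s : 0 <= s -> 2 ^+ k * s <= 2 * r0 ->
  psi (2 ^+ k * s) <= C0 ^+ k * psi s.
Proof.
move=> s0; elim: k => [|k ih]; first by rewrite !expr0 !mul1r.
have p0 : 0 <= 2 ^+ k * s by rewrite mulr_ge0// exprn_ge0.
rewrite exprS -mulrA ler_pM2l// => ksr.
apply: le_trans (half_line_inv_double _) _; first by rewrite p0.
rewrite exprS -mulrA ler_wpM2l ?(le_trans _ C0_ge1)//.
by apply: ih; lra.
Qed.

(** The doubling property is applied [k = floor alpha + 1] times. This is
    enough since [alpha <= 2 ^ k], and the bound on [s] allows it since
    [2 ^ (k - 1) <= 2 ^ alpha]. *)
Lemma half_line_inv_scale (alpha s : R) : 0 < alpha -> 0 <= s ->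
  s <= r0 / 2 `^ (1 + alpha) ->
  psi (alpha * s) <= C0 ^+ (Num.truncn alpha).+1 * psi s.
Proof.
move=> a0 s0 sr; set k := (Num.truncn alpha).+1.
have ak : alpha <= 2 ^+ k.
  apply: (@le_trans _ _ k%:R); first by rewrite ltW// truncnS_gt.
  by rewrite -natrX ler_nat ltnW// ltn_expl.
apply: (@le_trans _ _ (psi (2 ^+ k * s))).
  by apply: ler_half_line_inv; rewrite ?mulr_ge0 ?(ltW a0)// ler_wpM2r.
apply: half_line_inv_exp2 => //; rewrite exprS -mulrA ler_pM2l//.
have p0 : 0 < 2 `^ (1 + alpha) :> R by rewrite powR_gt0.
move: sr; rewrite ler_pdivlMr// mulrC; apply: le_trans.
rewrite ler_wpM2r// -powR_mulrn// ler_powR ?ler1n//.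
have : (Num.truncn alpha)%:R <= alpha by rewrite truncn_le ltW.
by lra.
Qed.

End half_line_inverse.

(** * Integrals of series of indicators, and the Whitney partition *)

Section nonmeasurable_integrand.
Context d (T : measurableType d) (R : realType).
Variables (mu : {measure set T -> \bar R}) (D : set T).

(** The integral of a nonnegative function is defined as a supremum over the
    simple functions below it, which is monotone in the function. *)
Lemma ge0_le_integral_nonmeasurable (f g : T -> \bar R) :
  (forall x, D x -> (0 <= f x)%E) -> (forall x, D x -> (f x <= g x)%E) ->
  (\int[mu]_(x in D) f x <= \int[mu]_(x in D) g x)%E.
Proof.
move=> f0 fg; have g0 x : D x -> (0 <= g x)%E.
  by move=> Dx; apply: le_trans (fg x Dx); exact: f0.
rewrite !ge0_integralE//; apply: ge_ereal_sup => _ [h hf <-].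
apply: ereal_sup_ubound; exists h => // x.
by apply: le_trans (hf x) _; exact: lee_restrict.
Qed.

(** Tonelli's theorem with a series for one of the integrals, applied to the
    bound of [f]. *)
Lemma integral_le_series_indic (f : T -> \bar R) (b : nat -> \bar R)
    (E : nat -> set T) :
  measurable D -> (forall j, measurable (E j)) -> (forall j, (0 <= b j)%E) ->
  (forall x, D x -> (0 <= f x)%E) ->
  (forall x, D x -> (f x <= \sum_(j <oo) b j * (\1_(E j) x)%:E)%E) ->
  (\int[mu]_(x in D) f x <= \sum_(j <oo) b j * mu (D `&` E j))%E.
Proof.
move=> mD mE b0 f0 fb; apply: le_trans (ge0_le_integral_nonmeasurable f0 fb) _.
have mI j : measurable_fun D (fun x => (\1_(E j) x)%:E : \bar R).
  exact/measurable_EFinP/measurable_indic.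
have I0 j x : (0 <= (\1_(E j) x)%:E :> \bar R)%E by rewrite lee_fin.
rewrite integral_nneseries//.
- apply: lee_nneseries => [j _ _|j _].
    by apply: integral_ge0 => *; exact: mule_ge0.
  by rewrite ge0_integralZl// integral_indic// setIC.
- by move=> j; exact: measurable_funeM.
- by move=> j x _; exact: mule_ge0.
Qed.

End nonmeasurable_integrand.

Lemma integral_partition d (T : measurableType d) (R : realType)
    (mu : {measure set T -> \bar R}) (B : set T) (Q : nat -> set T)
    (f : T -> \bar R) :
  measurable B -> (forall j, measurable (Q j)) -> trivIset setT Q ->
  measurable_fun B f -> (forall x, B x -> (0 <= f x)%E) ->
  B `<=` \bigcup_j Q j ->
  (\int[mu]_(x in B) f x = \sum_(j <oo) \int[mu]_(x in Q j `&` B) f x)%E.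
Proof.
move=> mB mQ tQ mf f0 BQ.
have BE : B = \bigcup_j (Q j `&` B).
  by rewrite -setI_bigcupl; apply/esym/setIidPr.
rewrite [in LHS]BE ge0_integral_bigcup//.
- by move=> j; exact: measurableI.
- by rewrite -BE.
- by rewrite -BE.
- by apply: trivIset_setIr.
Qed.

(** Comparability within a factor [c] passes to powers of either sign, which is
    why the exponent of [c] is an absolute value. *)
Lemma powR_comparable (R : realType) (a b c g : R) : 0 < a -> 0 < b -> 1 <= c ->
  a <= c * b -> b <= c * a -> a `^ g <= c `^ `|g| * b `^ g.
Proof.
move=> a0 b0 c1 ab ba; have c0 : 0 < c by exact: lt_le_trans c1.
have [g0|g0] := leP 0 g.
  rewrite ger0_norm// -powRM ?(ltW b0) ?(ltW c0)//.
  by rewrite ge0_ler_powR// ?nnegrE ?(ltW a0)// mulr_ge0 ?(ltW b0) ?(ltW c0).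
have : b `^ (- g) <= c `^ (- g) * a `^ (- g).
  rewrite -powRM ?(ltW a0) ?(ltW c0)// ge0_ler_powR// ?nnegrE ?(ltW b0) ?oppr_ge0
    ?(ltW g0)//.
  by rewrite mulr_ge0 ?(ltW a0) ?(ltW c0).
rewrite (powRN a) (powRN b) ltr0_norm// ler_pdivlMr ?powR_gt0// mulrC.
by rewrite ler_pdivrMr ?powR_gt0.
Qed.

Section whitney.
Context {R : realType} {n : nat}.
Local Notation lebT := (caratheodory_type (@lebesgue_outer R n)).

(** The balls [B(q, delta q / 9)] around the rational points of [D] cover [D],
    since a rational point [q] within [delta x / 10] of [x] has
    [delta q / 9 >= delta x / 10]; they are then made disjoint. *)
Lemma whitney_partition (D : set 'rV[R]_n) :
  open D -> D !=set0 -> boundary D !=set0 ->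
  exists (q : nat -> 'rV[R]_n) (Q : nat -> set lebT),
    [/\ forall j, D (q j), forall j, measurable (Q j), trivIset setT Q,
        D = \bigcup_j Q j &
        forall j x, Q j x -> enorm (x - q j) < bdist D (q j) / 9].
Proof.
move=> oD [x0 Dx0] bD.
pose q k : 'rV[R]_n := if unpickle k is Some v then
  if pselect (D (rat_point v)) then rat_point v else x0 else x0.
have Dq k : D (q k) by rewrite /q; case: unpickle => // v; case: pselect.
pose W k : set lebT := eball (q k) (bdist D (q k) / 9).
have mW k : measurable (W k) by exact: lebesgue_measurable_ball.
exists q, (seqDU W); split => //.
- by move=> j; apply: measurableD => //; exact: bigsetU_measurable.
- rewrite -seqDU_bigcup_eq; apply/seteqP; split => [x Dx|x [j _]]; last first.
    rewrite /W /eball/= => xq; apply: (eball_bdist oD (Dq j)).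
    by have := bdist_gt0 oD bD (Dq j); move: xq; lra.
  have d0 := bdist_gt0 oD bD Dx.
  have d10 : 0 < bdist D x / 10 by lra.
  have [v xv] := rat_point_dense x d10; exists (pickle v) => //.
  have Dv : D (rat_point v) by apply: (eball_bdist oD Dx); rewrite enormB; lra.
  have -> : W (pickle v) = eball (rat_point v) (bdist D (rat_point v) / 9).
    by rewrite /W /q pickleK; case: pselect.
  by rewrite /eball/=; have := bdist_lip D x (rat_point v); lra.
- by move=> j x; exact: (@subset_seqDU _ W j x).
Qed.

End whitney.

(** * The weighted mean value inequality *)

Section mean_value.
Context {R : realType} {n : nat}.
Local Notation lebT := (caratheodory_type (@lebesgue_outer R n)).
Variables (Omega : set 'rV[R]_n) (K gamma : R) (u : 'rV[R]_n -> R).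
Hypotheses (oO : open Omega) (bO : boundary Omega !=set0) (K1 : 1 <= K).
Hypothesis u0 : forall x, Omega x -> 0 <= u x.
Hypothesis qns : quasi_nearly_subharmonic K Omega (EFin \o u).
Local Notation delta := (bdist Omega).
Local Notation weighted := (fun x => (delta x `^ gamma * u x)%:E : \bar R).

Let mu_fun : measurable_fun (Omega : set lebT) u.
Proof. by have [_ + _ _] := qns => /measurable_EFinP. Qed.

Let mO : measurable (Omega : set lebT).
Proof. exact: lebesgue_measurable_open. Qed.

Lemma measurable_weighted : measurable_fun (Omega : set lebT) weighted.
Proof.
apply/measurable_EFinP; apply: measurable_funM => //.
apply: (measurableT_comp (measurable_powR gamma)).
apply: measurable_fun_rays => r; apply: measurableI => //.
by apply: lebesgue_measurable_open; exact: open_bdist_lt.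
Qed.

Lemma weighted_ge0 x : Omega x -> (0 <= weighted x)%E.
Proof. by move=> Ox; rewrite lee_fin mulr_ge0 ?powR_ge0 ?u0. Qed.

(** [3 ^+ n / nu] comes from the volume of a ball of radius [delta x / 3], the
    power of 2 from replacing [delta x] by [delta y] in the weight. *)
Definition mean_constant : R := K * 3 ^+ n / @nu R n * 2 `^ `|gamma|.

Lemma nu_ge0 : 0 <= @nu R n.
Proof. by rewrite fine_ge0// measure_ge0. Qed.

Lemma mean_constant_ge0 : 0 <= mean_constant.
Proof.
rewrite /mean_constant mulr_ge0 ?powR_ge0// divr_ge0 ?nu_ge0// mulr_ge0//.
exact: le_trans K1.
Qed.

Lemma third_ball_sub x : Omega x -> eball x (delta x / 3) `<=` Omega.
Proof.
move=> Ox y; rewrite /eball/= => yx; apply: (eball_bdist oO Ox).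
by have := bdist_gt0 oO bO Ox; move: yx; lra.
Qed.

(** The mean value inequality on [B(x, delta x / 3)], where [delta] varies by a
    factor at most 2, so that the weight can be moved inside the integral. *)
Lemma weighted_mean_value x : Omega x ->
  ((delta x `^ (n%:R + gamma) * u x)%:E <=
   mean_constant%:E * \int[leb]_(y in eball x (delta x / 3)) weighted y)%E.
Proof.
move=> Ox; have d0 := bdist_gt0 oO bO Ox.
set B := eball x _; have BO : B `<=` Omega := third_ball_sub Ox.
have mB : measurable (B : set lebT) by exact: lebesgue_measurable_ball.
have muB : measurable_fun (B : set lebT) (fun y => (u y)%:E : \bar R).
  by apply/measurable_EFinP; exact: (measurable_funS mO BO mu_fun).
have cutoff0 y : Omega y -> cutoff 0 (EFin \o u) y = (u y)%:E.
  by move=> Oy; rewrite /cutoff/= oppr0 adde0 max_l// lee_fin u0.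
have ecb : ecball x (delta x / 3) `<=` Omega.
  by move=> y; rewrite /ecball/= => yx; apply: (eball_bdist oO Ox); lra.
have [_ _ _ mean] := qns.
have {mean} := mean x (delta x / 3) 0 _ ecb (lexx 0).
rewrite divr_gt0// => /(_ isT); rewrite cutoff0// -/B.
have -> : (\int[leb]_(y in B) cutoff 0 (EFin \o u) y =
    \int[leb]_(y in B) (u y)%:E)%E.
  by apply: eq_integral => y; rewrite inE => /BO; exact: cutoff0.
set I := integral _ _ _ => mean.
have I0 : (0 <= I)%E by apply: integral_ge0 => y /BO /u0; rewrite lee_fin.
have wI : ((delta x `^ gamma)%:E * I <=
    (2 `^ `|gamma|)%:E * \int[leb]_(y in B) weighted y)%E.
  have u0B y : B y -> (0 <= (u y)%:E)%E by move=> /BO /u0; rewrite lee_fin.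
  have mwB : measurable_fun (B : set lebT) weighted.
    exact: (measurable_funS mO BO measurable_weighted).
  have w0B y : B y -> (0 <= weighted y)%E by move=> /BO/weighted_ge0.
  rewrite -!ge0_integralZl ?lee_fin ?powR_ge0//.
  apply: ge0_le_integral_nonmeasurable => y By.
    by apply: mule_ge0; [rewrite lee_fin powR_ge0|exact: u0B].
  rewrite -!EFinM lee_fin mulrA ler_wpM2r ?u0//; first exact: BO.
  have := bdist_lip Omega x y; have := bdist_lip Omega y x.
  move: By; rewrite /B /eball/= (enormB x y) => xy yx1 yx2.
  by apply: powR_comparable; lra.
rewrite powRD ?(gt_eqF d0) ?implybT// powR_mulrn ?(ltW d0)// -mulrA.
have -> : mean_constant = delta x ^+ n * (K / (@nu R n * (delta x / 3) ^+ n)) *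
    2 `^ `|gamma|.
  rewrite /mean_constant; congr (_ * _); rewrite exprMn exprVn !invfM invrK.
  rewrite [RHS]mulrCA -[LHS]mulrA; congr (_ * _).
  by rewrite [RHS]mulrCA mulVKf ?expf_neq0 ?lt0r_neq0// mulrC.
set k := K / _ in mean *.
have k0 : 0 <= k.
  apply: divr_ge0; first exact: le_trans K1.
  by rewrite mulr_ge0 ?nu_ge0// exprn_ge0// divr_ge0// ltW.
have dn0 : 0 <= delta x ^+ n by rewrite exprn_ge0// ltW.
set J := integral _ _ _ in wI *.
apply: (@le_trans _ _ ((delta x ^+ n * k)%:E * ((delta x `^ gamma)%:E * I))%E).
  rewrite (_ : _ * (_ * I) =
      (delta x ^+ n * delta x `^ gamma)%:E * (k%:E * I))%E; last first.
    by rewrite !muleA -!EFinM; congr (_%:E * _)%E; ring.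
  rewrite [in leLHS]mulrA EFinM; apply: lee_wpmul2l => //.
  by rewrite lee_fin mulr_ge0 ?powR_ge0.
rewrite [in leRHS]EFinM -muleA; apply: lee_wpmul2l => //.
by rewrite lee_fin mulr_ge0.
Qed.

End mean_value.

(** * Approach regions and the integral inequality *)

Section approach_geometry.
Context {R : realType} {n : nat}.
Variables (Omega : set 'rV[R]_n) (phi : R -> R) (C0 r0 alpha : R).
Hypotheses (oO : open Omega) (bO : boundary Omega !=set0).
Hypotheses (adm : admissible phi C0 r0) (alpha0 : 0 < alpha).
Local Notation delta := (bdist Omega).
Local Notation psi := (half_line_inv phi).

(** [floor alpha + 1] factors [C0] lead from [psi (alpha * delta x)] to
    [psi (delta x)], one more from there to [psi (delta q)]; the factor 2 is for
    [|zeta - q| <= |zeta - x| + |x - q|], whose second term is at most the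
    first. *)
Definition aperture : R := 2 * C0 ^+ (Num.truncn alpha).+2.

Lemma aperture_gt0 : 0 < aperture.
Proof.
have [[C01 _] _ _ _ _] := adm.
by rewrite mulr_gt0// exprn_gt0// (lt_le_trans ltr01).
Qed.

(** The boundary points from whose approach regions a Whitney piece around [q]
    can be seen lie within [psi (delta q)] of [q], up to a constant. That
    [delta x] is itself at most of that order comes from [x] lying in an
    approach region: [delta x <= |x - zeta| < psi (alpha * delta x)]. *)
Lemma approach_whitney zeta x y q :
  boundary Omega zeta -> approach Omega phi zeta alpha x ->
  delta x < r0 / 2 `^ (1 + alpha) -> Omega q ->
  enorm (y - x) < delta x / 3 -> enorm (y - q) < delta q / 9 ->
  [/\ psi (delta x) <= C0 * psi (delta q), psi (delta q) <= C0 * psi (delta x)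
    & eball q (aperture * psi (delta q)) zeta].
Proof.
move=> bz [Ox xz] xr Oq yx yq.
have [[C01 r00] _ _ _ _] := adm; have C00 : 0 < C0 by apply: lt_le_trans C01.
have dx0 := bdist_gt0 oO bO Ox; have dq0 := bdist_gt0 oO bO Oq.
have xq : enorm (x - q) <= enorm (y - x) + enorm (y - q).
  by rewrite (enormB y x) enorm_triangle.
have dxq : delta x <= delta q + enorm (x - q) := bdist_lip Omega x q.
have dqx : delta q <= delta x + enorm (x - q).
  by rewrite (enormB x); exact: bdist_lip.
have xr2 : 2 * delta x < r0.
  rewrite mulrC -ltr_pdivlMr//; apply: lt_le_trans xr _.
  rewrite ler_wpM2l ?(ltW r00)// lef_pV2 ?posrE ?powR_gt0//.
  by rewrite -[leLHS](powRr1 (ler0n _ _)) ler_powR ?ler1n// lerDl ltW.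
have psi_xq : psi (delta x) <= C0 * psi (delta q).
  apply: le_trans (half_line_inv_double adm _); last by apply/andP; split; lra.
  by apply: (ler_half_line_inv adm); lra.
have psi_qx : psi (delta q) <= C0 * psi (delta x).
  apply: le_trans (half_line_inv_double adm _); last by apply/andP; split; lra.
  by apply: (ler_half_line_inv adm); lra.
split => //.
have xz_psi : enorm (x - zeta) < psi (alpha * delta x).
  rewrite -(half_line_invKV adm (enorm_ge0 (x - zeta))).
  apply: (ltr_half_line_inv adm) => //.
  by apply: (admissible_ge0 adm); exact: enorm_ge0.
have scale := half_line_inv_scale adm alpha0 (ltW dx0) (ltW xr).
have scale_q : psi (alpha * delta x) <= C0 ^+ (Num.truncn alpha).+2 * psi (delta q).
  apply: le_trans scale _; rewrite [in leRHS]exprSr -mulrA.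
  by rewrite ler_wpM2l// exprn_ge0// ltW.
have dxz : delta x <= enorm (x - zeta) := bdist_le x bz.
have := enorm_triangle x zeta q; rewrite (enormB zeta x).
by rewrite /eball /aperture/= -mulrA; lra.
Qed.

End approach_geometry.

(** Regularity concerns balls centred on [E]; a ball that meets [E] is contained
    in one of twice the radius centred at a common point. *)
Lemma hausdorff_eball_le (R : realType) (n : nat) (d C4 : R) (E : set 'rV[R]_n)
    (q : 'rV[R]_n) (r : R) : 0 < r -> 0 <= C4 ->
  (forall (x : 'rV[R]_n) (r : R), E x -> 0 < r ->
     (hausdorff d (E `&` eball x r) <= (C4 * r `^ d)%:E)%E) ->
  (hausdorff d (E `&` eball q r) <= (C4 * (2 * r) `^ d)%:E)%E.
Proof.
move=> r0 C40 reg; have [[z [Ez qz]]|nE] := pselect (E `&` eball q r !=set0).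
  apply: le_trans (reg z (2 * r) Ez _); last by rewrite mulr_gt0.
  apply: homo_hausdorff_outer => y [Ey qy]; split=> //.
  have := enorm_triangle q y z; rewrite (enormB q z).
  by move: qy qz; rewrite /eball/=; lra.
rewrite (_ : E `&` eball q r = set0).
  by rewrite measure0 lee_fin mulr_ge0// powR_ge0.
by apply/seteqP; split => // y Ey; apply: nE; exists y.
Qed.

Section main.
Context {R : realType} {n : nat}.
Variables (d : R) (Omega : set 'rV[R]_n) (K : R) (phi : R -> R).
Variables (C0 r0 alpha gamma C4 : R).
Hypotheses (dO : domain Omega) (OT : Omega <> setT).
Hypotheses (cbO : closed (boundary Omega)) (C40 : 0 < C4).
Hypothesis reg : forall (x : 'rV[R]_n) (r : R), boundary Omega x -> 0 < r ->
  (hausdorff d (boundary Omega `&` eball x r) <= (C4 * r `^ d)%:E)%E.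
Hypotheses (K1 : 1 <= K) (adm : admissible phi C0 r0) (alpha0 : 0 < alpha).
Local Notation delta := (bdist Omega).
Local Notation psi := (half_line_inv phi).
Local Notation lebT := (caratheodory_type (@lebesgue_outer R n)).
Local Notation A := (aperture C0 alpha).

Let oO : open Omega. Proof. by have [] := dO. Qed.
Let bO : boundary Omega !=set0.
Proof. by have [? _ ?] := dO; exact: boundary_nonempty. Qed.
Let C01 : 1 <= C0. Proof. by have [[]] := adm. Qed.

(** One factor for each estimate: the mean value inequality, the replacement of
    [psi (delta x)] by its value at a Whitney centre, and the Hausdorff measure
    of the ball around that centre. *)
Definition maximal_constant : R :=
  mean_constant (n := n) K gamma * C0 `^ `|- d| * (C4 * (2 * A) `^ d).

Lemma maximal_constant_ge0 : 0 <= maximal_constant.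
Proof.
rewrite /maximal_constant mulr_ge0//.
  by rewrite mulr_ge0 ?powR_ge0// mean_constant_ge0.
by rewrite mulr_ge0 ?powR_ge0// ltW.
Qed.

Lemma maximal_inequality (u : 'rV[R]_n -> R) (rho : R) :
  (forall x, Omega x -> 0 <= u x) ->
  quasi_nearly_subharmonic K Omega (EFin \o u) ->
  rho <= r0 / 2 `^ (1 + alpha) ->
  (\int[hausdorff d]_(zeta in boundary Omega)
     sup_nneg (truncated_approach Omega phi rho zeta alpha)
       (fun x => (delta x `^ (n%:R + gamma) * psi (delta x) `^ (- d) * u x)%R)
   <= maximal_constant%:E * \int[leb]_(x in boundary_strip Omega (4 / 3 * rho)%R)
                (delta x `^ gamma * u x)%:E)%E.
Proof.
move=> u0 qns rho_le.
pose F x := (delta x `^ gamma * u x)%:E : \bar R.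
pose strip := boundary_strip Omega (4 / 3 * rho).
have nO : Omega !=set0 by have [] := dO.
have [q [Q [Oq mQ tQ OQ Qq]]] := whitney_partition oO nO bO.
have QO j : Q j `<=` Omega by move=> x Qx; rewrite OQ; exists j.
have mstrip : measurable (strip : set lebT).
  apply: measurableI; first exact: lebesgue_measurable_open.
  by apply: lebesgue_measurable_open; exact: open_bdist_lt.
have stripO : strip `<=` Omega by move=> x [].
have mF : measurable_fun (Omega : set lebT) F := measurable_weighted gamma oO qns.
have F0 x : Omega x -> (0 <= F x)%E by exact: weighted_ge0.
have mOmega : measurable (Omega : set lebT) by exact: lebesgue_measurable_open.
pose c1 := mean_constant (n := n) K gamma.
have c10 : 0 <= c1 by exact: mean_constant_ge0.
pose c2 := c1 * C0 `^ `|- d|.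
have c20 : 0 <= c2 by rewrite mulr_ge0 ?powR_ge0.
pose a j : \bar R := (\int[leb]_(x in Q j `&` strip) F x)%E.
have a0 j : (0 <= a j)%E by apply: integral_ge0 => x [/QO Ox _]; exact: F0.
have dq0 j : 0 < delta (q j) by exact: bdist_gt0.
have psiq0 j : 0 < psi (delta (q j)) by exact: (half_line_inv_gt0 adm).
pose b j : \bar R := ((c2 * psi (delta (q j)) `^ (- d))%:E * a j)%E.
have b0 j : (0 <= b j)%E.
  by apply: mule_ge0 => //; rewrite lee_fin mulr_ge0 ?powR_ge0.
pose E j := eball (q j) (A * psi (delta (q j))).
have A0 : 0 < A by exact: (aperture_gt0 _ adm).
apply: (@le_trans _ _ (\sum_(j <oo) b j * hausdorff d (boundary Omega `&` E j))%E).
  apply: integral_le_series_indic => //.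
  - rewrite -[boundary Omega]setCK.
    by apply/measurableC/hausdorff_measurable_open; exact: closed_openC.
  - by move=> j; exact: hausdorff_measurable_ball.
  - by move=> zeta _; rewrite /sup_nneg le_max lexx.
  move=> zeta bz.
  have bI0 j : (0 <= b j * (\1_(E j) zeta)%:E)%E by apply: mule_ge0.
  rewrite /sup_nneg ge_max; apply/andP; split; first exact: nneseries_ge0.
  apply: ge_ereal_sup => _ [x [ax xrho] <-].
  have Ox : Omega x by case: ax.
  have dx0 := bdist_gt0 oO bO Ox.
  have psix0 : 0 < psi (delta x) by exact: (half_line_inv_gt0 adm).
  pose B := eball x (delta x / 3).
  have BO : B `<=` Omega := third_ball_sub oO bO Ox.
  have mB : measurable (B : set lebT) by exact: lebesgue_measurable_ball.
  have Bstrip : B `<=` strip.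
    move=> y By; split; first exact: BO.
    by have := bdist_lip Omega y x; move: By; rewrite /B /eball/=; lra.
  have mean := weighted_mean_value gamma oO bO K1 u0 qns Ox.
  have part : (\int[leb]_(y in B) F y = \sum_(j <oo) \int[leb]_(y in Q j `&` B) F y)%E.
    apply: integral_partition => //.
    - exact: (measurable_funS mOmega BO mF).
    - by move=> y /BO/F0.
    - by rewrite -OQ.
  have IQB0 j : (0 <= \int[leb]_(y in Q j `&` B) F y)%E.
    by apply: integral_ge0 => y [/QO/F0].
  (* The mean value inequality, with the ball cut along the Whitney pieces. *)
  apply: (@le_trans _ _ (\sum_(j <oo) (psi (delta x) `^ (- d) * c1)%:E *
      \int[leb]_(y in Q j `&` B) F y)%E).
    rewrite nneseriesZl// -part [in leRHS]EFinM -muleA.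
    rewrite [in leLHS]mulrAC [in leLHS]mulrC [in leLHS]EFinM.
    by apply: lee_wpmul2l => //; rewrite lee_fin powR_ge0.
  apply: lee_nneseries => [j _ _|j _].
    by apply: mule_ge0 => //; rewrite lee_fin mulr_ge0 ?powR_ge0.
  (* A piece that meets the ball has [zeta] in the ball around its centre. *)
  have [[y [Qy By]]|nQB] := pselect (Q j `&` B !=set0); last first.
    rewrite (_ : Q j `&` B = set0) ?integral_set0 ?mule0//.
    by apply/seteqP; split => // y QBy; apply: nQB; exists y.
  have [psi_xq psi_qx Ez] := approach_whitney oO bO adm alpha0 bz ax
    (lt_le_trans xrho rho_le) (Oq j) By (Qq j y Qy).
  rewrite indicE mem_set// mule1; apply: lee_pmul => //.
  - by rewrite lee_fin mulr_ge0 ?powR_ge0.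
  - rewrite lee_fin /c2 mulrC -mulrA ler_wpM2l//.
    exact: powR_comparable.
  - apply: ge0_subset_integral.
    + exact: measurableI.
    + exact: measurableI.
    + by apply: (measurable_funS mOmega _ mF) => y' [/QO].
    + by move=> y' [/QO/F0].
    + exact: setIS.
have aE : (\int[leb]_(x in strip) F x = \sum_(j <oo) a j)%E.
  apply: integral_partition => //.
  - exact: (measurable_funS mOmega stripO mF).
  - by move=> y /stripO/F0.
  - by rewrite -OQ.
rewrite aE -nneseriesZl//; apply: lee_nneseries => [j _ _|j _].
  by apply: mule_ge0.
apply: (@le_trans _ _ (b j * (C4 * (2 * (A * psi (delta (q j)))) `^ d)%:E)%E).
  apply: lee_wpmul2l => //; apply: hausdorff_eball_le => //; last exact: ltW.
  by rewrite mulr_gt0.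
rewrite /b muleAC -EFinM; apply: lee_wpmul2r => //; rewrite lee_fin.
have -> : (2 * (A * psi (delta (q j)))) `^ d =
    (2 * A) `^ d * psi (delta (q j)) `^ d.
  by rewrite mulrA powRM// ?ltW// mulr_gt0.
rewrite powRN /maximal_constant -/c1 -/c2; set p := psi _ `^ d.
have p0 : p != 0 by rewrite gt_eqF// powR_gt0.
rewrite [leLHS](_ : _ = c2 * (C4 * (2 * A) `^ d))//.
by generalize c2 C4 ((2 * A) `^ d) p p0 => x y z t t0; field.
Qed.

End main.

Theorem theorem1 (R : realType) (n : nat) (d : R) (Omega : set 'rV[R]_n)
    (K : R) (phi : R -> R) (C0 r0 alpha gamma : R) :
  (2 <= n)%N -> 0 <= d <= n%:R ->
  domain Omega -> Omega <> setT -> ahlfors_regular d (boundary Omega) ->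
  1 <= K -> admissible phi C0 r0 -> 0 < alpha ->
  let delta := bdist Omega in
  let rho0 :=
    Num.min (Num.min (r0 / 2 `^ (1 + alpha)) (r0 / 2 `^ (3 * alpha * C0)))
      (phi r0 / alpha) in
  exists2 C : R, 0 < C &
    forall u : 'rV[R]_n -> R,
      (forall x, Omega x -> 0 <= u x) ->
      quasi_nearly_subharmonic K Omega (EFin \o u) ->
      (\int[leb]_(x in Omega) (delta x `^ gamma * u x)%:E < +oo)%E ->
      forall rho : R, 0 < rho <= rho0 ->
        (\int[hausdorff d]_(zeta in boundary Omega)
           sup_nneg (truncated_approach Omega phi rho zeta alpha)
             (fun x => (delta x `^ (n%:R + gamma)
                        * half_line_inv phi (delta x) `^ (- d) * u x)%R)
         <= C%:E * \int[leb]_(x in boundary_strip Omega (4 / 3 * rho)%R)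
                      (delta x `^ gamma * u x)%:E)%E.
Proof.
move=> _ _ dO OT [cbO [C4 C40 [reg _]]] K1 adm alpha0 delta rho0.
have c0 := maximal_constant_ge0 (n := n) d C0 alpha gamma C40 K1.
exists (maximal_constant (n := n) d K C0 alpha gamma C4 + 1).
  by rewrite ltr_wpDl.
move=> u u0 qns _ rho /andP[_ rho_le].
have rho_le' : rho <= r0 / 2 `^ (1 + alpha).
  by move: rho_le; rewrite /rho0 !le_min => /andP[/andP[]].
apply: le_trans (maximal_inequality gamma dO OT cbO C40 reg K1 adm alpha0 u0 qns
  rho_le') _.
apply: lee_wpmul2r; last by rewrite lee_fin lerDl.
apply: integral_ge0 => x [Ox _].
by rewrite lee_fin mulr_ge0 ?powR_ge0 ?u0.
Qed.
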